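(* Let $D$ be a diagonal $n\times n$ matrix with positive diagonal entries $\lambda_1,\dots,\lambda_n$. Then $$\operatorname{dist}(D,SO(n,\mathbb{R}))=d(D,I).$$ Moreover, $I$ is the unique minimizer (i.e. the unique point of $SO(n,\mathbb{R})$ realizing this distance) and the associated minimal geodesic (joining $I$ to $D$, $t\in[0,1]$) is given by $\gamma(t)=e^{t\log D}$.
   Context: $GL^+(n,\mathbb{R})$, the group of real $n\times n$ matrices with positive determinant, is equipped with the left-invariant Riemannian metric generated by the Euclidean inner product at $I$, i.e. $g_A(X,Y)=\mathrm{tr}\big((A^{-1}X)^T(A^{-1}Y)\big)$ for $A\in GL^+(n,\mathbb{R})$ and $X,Y\in T_AGL^+(n,\mathbb{R})=M(n,\mathbb{R})$. $d$ is the induced Riemannian distance and $\operatorname{dist}(D,SO(n,\mathbb{R}))=\inf_{B\in SO(n,\mathbb{R})}d(D,B)$. $\log D$ is the diagonal matrix with entries $\log\lambda_1,\dots,\log\lambda_n$. *)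

(* Defs.v *)
From HB Require Import structures.
From mathcomp Require Import all_boot all_order all_algebra.
From mathcomp Require Import all_classical all_reals all_analysis.

Set Implicit Arguments.
Unset Strict Implicit.
Unset Printing Implicit Defensive.

Import Order.TTheory GRing.Theory Num.Theory.
Import numFieldNormedType.Exports.

Local Open Scope ring_scope.
Local Open Scope classical_set_scope.

Section MatrixGroups.
Context {R : realType} {n : nat}.

Definition GLpos : set 'M[R]_n := [set A | 0 < \det A].

Definition SO : set 'M[R]_n := [set B | B^T *m B = 1%:M /\ \det B = 1].

Definition expmx (A : 'M[R]_n) : 'M[R]_n :=
  limn (series (fun k => (k`!%:R)^-1 *: A ^+ k)).

End MatrixGroups.

Section Curves.
Context {R : realType} {V : normedModType R}.

Definition Ck (k : nat) (sigma : R -> V) : Prop :=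
  (forall j, (j < k)%N -> forall t, derivable sigma^`(j) t 1) /\
  (forall j, (j <= k)%N -> continuous sigma^`(j)).

(* On a compact interval, being C^k with one-sided derivatives at the ends is
   the same as being the restriction of a C^k curve defined on the whole line. *)
Definition Ck_on (k : nat) (a b : R) (gamma : R -> V) : Prop :=
  exists2 sigma : R -> V, Ck k sigma & {in `[a, b]%R, gamma =1 sigma}.

(* The subdivision is 0 < s_0 < s_1 < ... < last 0 s = 1. The pieces are closed
   intervals sharing their end points, so gamma is continuous on [0, 1]. *)
Definition piecewise_C1 (gamma : R -> V) : Prop :=
  exists s : seq R, [/\ path <%R 0 s, last 0 s = 1 &
    forall i, (i < size s)%N ->
      Ck_on 1 (nth 0 (0 :: s) i) (nth 0 (0 :: s) i.+1) gamma].

End Curves.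

Section LeftInvariantMetric.
Context {R : realType} {n : nat}.
Implicit Types (A B X Y Z : 'M[R]_n) (gamma : R -> 'M[R]_n).

Definition metric A X Y : R := \tr ((invmx A *m X)^T *m (invmx A *m Y)).

Definition joins A B gamma : Prop :=
  [/\ gamma 0 = A, gamma 1 = B & {in `[0, 1]%R, forall t, GLpos (gamma t)}].

Definition speed gamma (t : R) : R :=
  Num.sqrt (metric (gamma t) (derive1 gamma t) (derive1 gamma t)).

(* derive1 gamma is meaningless at 0, at 1 and at the break points of a piecewise
   C^1 curve; these form a null set. *)
Definition curve_length gamma : \bar R :=
  (\int[lebesgue_measure]_(t in `[0%R, 1%R]) (speed gamma t)%:E)%E.

Definition rdist A B : \bar R :=
  ereal_inf [set curve_length gamma | gamma in
    [set gamma | piecewise_C1 gamma /\ joins A B gamma]].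

Definition rdist_set A (S : set 'M[R]_n) : \bar R :=
  ereal_inf [set rdist A B | B in S].

(* Christoffel symbols of the first kind of the metric, in the global chart
   given by the inclusion of GL^+ in the vector space of matrices: this is
   g(nabla_X Y, Z) for the Levi-Civita connection and the constant vector
   fields X, Y, Z, as given by Koszul's formula. *)
Definition christoffel A X Y Z : R :=
  2^-1 * ('D_X (fun P => metric P Y Z) A + 'D_Y (fun P => metric P X Z) A
          - 'D_Z (fun P => metric P X Y) A).

(* The equation says that the covariant acceleration of gamma is orthogonal to
   every Z, hence zero. By continuity it also holds at the end points. *)
Definition geodesic gamma : Prop :=
  Ck_on 2 0 1 gamma /\
  {in `]0, 1[%R, forall t, forall Z,
    metric (gamma t) (derive1n 2 gamma t) Z
    + christoffel (gamma t) (derive1 gamma t) (derive1 gamma t) Z = 0}.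

Definition minimal_geodesic A B gamma : Prop :=
  [/\ joins A B gamma, geodesic gamma & curve_length gamma = rdist A B].

End LeftInvariantMetric.

(* Main.v *)
Require Import Defs.
From HB Require Import structures.
From mathcomp Require Import all_boot all_order all_algebra.
From mathcomp Require Import all_classical all_reals all_analysis.
From mathcomp Require Import ring lra.

Set Implicit Arguments.
Unset Strict Implicit.
Unset Printing Implicit Defensive.

Import Order.TTheory GRing.Theory Num.Theory.
Import numFieldNormedType.Exports.

Local Open Scope ring_scope.
Local Open Scope classical_set_scope.

(** Gram-Schmidt on the rows writes an invertible matrix as [X = L K], with [L]
    lower triangular with positive diagonal and [K] orthogonal. Send [X] to the
    Euclidean vector whose coordinates are the [log L_ii] and the
    [K_ij / sqrt 2]. This map ([chart]) is 1-Lipschitz for the left-invariant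
    metric. Indeed, along a curve, [Z = K X^-1 X' K^T] has the same norm as
    [X^-1 X'], and [Z = L^-1 L' + K' K^T]. The first term is lower triangular with
    diagonal [(log L_ii)'], the second is skew; so the diagonal of [Z] is
    [(log L_ii)'] and its strict upper part is that of [K' K^T], which carries
    half of [|K'|^2]. Therefore
      [|X^-1 X'|^2 >= sum_i ((log L_ii)')^2 + |K'|^2 / 2]  ([frame_velocity]).

    The chart maps [D] to [(log lambda, 1 / sqrt 2)] and a rotation [B] to
    [(0, B / sqrt 2)]. Hence
      [d(D, B)^2 >= |log lambda|^2 + |B - 1|^2 / 2]  ([rdist_ge], [chart_dist]),
    while the curve [exp (t log D)] has length [|log lambda|]
    ([exp_curve_length]). Both the value of the distance to the rotations and the
    uniqueness of the nearest rotation follow.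

    That [exp (t log D)] is a geodesic is a computation with the Christoffel
    symbols ([exp_curve_geodesic]). Conversely, a minimal geodesic from 1 to [D]
    has constant speed [|log lambda|], which is also the distance between the
    images of its ends in the chart. Since Euclidean segments are the only
    shortest curves, the chart sends it to a segment covered at constant speed:
    [K = 1] and [log L_ii = t log lambda_i] throughout. The diagonal of
    [X^-1 X'] is then [log lambda], which exhausts the norm of [X^-1 X'], so
    [X' = X log D], and the solution starting at 1 is [exp (t log D)]
    ([minimal_geodesic_diag]). *)

(** * Euclidean norms and orthogonality of rows *)

Section Euclid.
Context {R : realType} {I : finType}.
Implicit Types v w : I -> R.

Definition norm2 v : R := Num.sqrt (\sum_i v i ^+ 2).

Lemma sum_sqr_ge0 v : 0 <= \sum_i v i ^+ 2.
Proof. by apply: sumr_ge0 => i _; exact: sqr_ge0. Qed.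

Lemma norm2_ge0 v : 0 <= norm2 v.
Proof. exact: sqrtr_ge0. Qed.

Lemma sqr_norm2 v : norm2 v ^+ 2 = \sum_i v i ^+ 2.
Proof. by rewrite sqr_sqrtr// sum_sqr_ge0. Qed.

Lemma sum_sqr_eq0 v : \sum_i v i ^+ 2 = 0 -> forall i, v i = 0.
Proof.
move/eqP; rewrite psumr_eq0 => [/allP h i|i _]; last exact: sqr_ge0.
by apply/eqP; rewrite -sqrf_eq0; apply: h; rewrite mem_index_enum.
Qed.

Lemma cauchy_schwarz v w : \sum_i v i * w i <= norm2 v * norm2 w.
Proof.
have [v0|v0] := eqVneq (norm2 v) 0.
  have h : \sum_i v i ^+ 2 = 0 by rewrite -sqr_norm2 v0 expr0n.
  by rewrite v0 mul0r big1// => i _; rewrite (sum_sqr_eq0 h) mul0r.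
have [w0|w0] := eqVneq (norm2 w) 0.
  have h : \sum_i w i ^+ 2 = 0 by rewrite -sqr_norm2 w0 expr0n.
  by rewrite w0 mulr0 big1// => i _; rewrite (sum_sqr_eq0 h) mulr0.
have p : 0 < norm2 v * norm2 w.
  by rewrite mulr_gt0// lt_neqAle eq_sym ?v0 ?w0 norm2_ge0.
suff : 0 <= 2 * (norm2 v * norm2 w) * (norm2 v * norm2 w - \sum_i v i * w i).
  by rewrite pmulr_rge0 ?subr_ge0// pmulr_rgt0.
have := sum_sqr_ge0 (fun i => norm2 w * v i - norm2 v * w i).
have e i : (norm2 w * v i - norm2 v * w i) ^+ 2 =
    norm2 w ^+ 2 * v i ^+ 2 + norm2 v ^+ 2 * w i ^+ 2
    - 2 * (norm2 v * norm2 w) * (v i * w i) by ring.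
rewrite (eq_bigr _ (fun i _ => e i)) !big_split/= sumrN -!mulr_sumr -!sqr_norm2.
by move=> h; apply: le_trans h _; rewrite le_eqVlt; apply/orP; left; apply/eqP; ring.
Qed.

End Euclid.

Section Frobenius.
Context {R : realType} {n : nat}.
Implicit Types A B : 'M[R]_n.

Definition frob2 A : R := \tr (A^T *m A).

Lemma frob2E A : frob2 A = \sum_i \sum_j A i j ^+ 2.
Proof.
rewrite /frob2 /mxtrace exchange_big/=; apply: eq_bigr => i _.
by rewrite mxE; apply: eq_bigr => j _; rewrite mxE expr2.
Qed.

Lemma frob2_ge0 A : 0 <= frob2 A.
Proof. by rewrite frob2E; do 2!apply: sumr_ge0 => ? _; exact: sqr_ge0. Qed.

Lemma frob2_eq0 A : frob2 A = 0 -> A = 0.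
Proof.
rewrite frob2E pair_big => /(@sum_sqr_eq0 _ _ (fun p => A p.1 p.2)) h.
by apply/matrixP => i j; rewrite mxE (h (i, j)).
Qed.

Lemma frob2_mull A K : K *m K^T = 1%:M -> frob2 (K *m A) = frob2 A.
Proof.
by move=> /mulmx1C KK; rewrite /frob2 trmx_mul -mulmxA (mulmxA K^T) KK mul1mx.
Qed.

Lemma frob2_mulr A K : K *m K^T = 1%:M -> frob2 (A *m K^T) = frob2 A.
Proof.
move=> /mulmx1C KK; rewrite /frob2 trmx_mul trmxK -mulmxA mxtrace_mulC -!mulmxA.
by rewrite KK mulmx1.
Qed.

Lemma frob2_conj A K : K *m K^T = 1%:M -> frob2 (K *m A *m K^T) = frob2 A.
Proof. by move=> KK; rewrite frob2_mulr// frob2_mull. Qed.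

End Frobenius.

(** * Gram-Schmidt orthonormalization of the rows of a matrix *)

Lemma ord_strong_ind n (P : 'I_n -> Prop) :
  (forall i : 'I_n, (forall j : 'I_n, (j < i)%N -> P j) -> P i) -> forall i, P i.
Proof.
move=> h i; move: {2}(i : nat) (leqnn i) => m.
elim: m i => [|m ih] i im; apply: h => j ji.
  by move: (leq_trans ji im); rewrite ltn0.
by apply: ih; rewrite -ltnS (leq_trans ji).
Qed.

Section GramSchmidt.
Context {R : realType} {n : nat}.
Implicit Types (X : 'M[R]_n) (x y z : 'rV[R]_n).

Definition dotr x y : R := \sum_j x 0 j * y 0 j.

Lemma dotrC x y : dotr x y = dotr y x.
Proof. by apply: eq_bigr => j _; rewrite mulrC. Qed.

Lemma dotrZl a x y : dotr (a *: x) y = a * dotr x y.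
Proof. by rewrite /dotr mulr_sumr; apply: eq_bigr => j _; rewrite mxE mulrA. Qed.

Lemma dotrZr a x y : dotr x (a *: y) = a * dotr x y.
Proof. by rewrite dotrC dotrZl dotrC. Qed.

Lemma dotrDl x y z : dotr (x + y) z = dotr x z + dotr y z.
Proof. by rewrite -big_split; apply: eq_bigr => j _; rewrite mxE mulrDl. Qed.

Lemma dotrNl x y : dotr (- x) y = - dotr x y.
Proof. by rewrite -scaleN1r dotrZl mulN1r. Qed.

Lemma dotr0l y : dotr 0 y = 0.
Proof. by rewrite -(scale0r 0) dotrZl mul0r. Qed.

Lemma dotr_suml (J : finType) (P : pred J) (f : J -> 'rV_n) y :
  dotr (\sum_(i | P i) f i) y = \sum_(i | P i) dotr (f i) y.
Proof.
elim/big_rec2: _ => [|i a b _ <-]; first exact: dotr0l.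
by rewrite dotrDl.
Qed.

Lemma dotr_ge0 x : 0 <= dotr x x.
Proof. by apply: sumr_ge0 => j _; rewrite -expr2 sqr_ge0. Qed.

Lemma dotr_gt0 x : x != 0 -> 0 < dotr x x.
Proof.
move=> x0; rewrite lt_neqAle dotr_ge0 andbT eq_sym; apply: contra x0 => /eqP h.
apply/eqP/rowP => j; rewrite mxE; apply: (@sum_sqr_eq0 R _ (fun j => x 0 j)).
by rewrite -[RHS]h; apply: eq_bigr => k _; rewrite expr2.
Qed.

Lemma mulmx_trE (A B : 'M[R]_n) i j : (A *m B^T) i j = dotr (row i A) (row j B).
Proof. by rewrite mxE; apply: eq_bigr => k _; rewrite !mxE. Qed.

(** The value at 0 is 0, because the inverse of 0 is 0. *)
Definition unit_row x : 'rV_n := (Num.sqrt (dotr x x))^-1 *: x.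

(** Row [i] calls the rows [j < i] only, so any fuel [m > i] gives the same
    value; see [gs_rec_fuel]. *)
Fixpoint gs_rec X (m : nat) (i : 'I_n) : 'rV[R]_n :=
  if m is m'.+1 then
    unit_row (row i X
      - \sum_(j < n | (j < i)%N) dotr (row i X) (gs_rec X m' j) *: gs_rec X m' j)
  else 0.

Definition gs_row X (i : 'I_n) : 'rV[R]_n := gs_rec X i.+1 i.

Definition gs_res X (i : 'I_n) : 'rV[R]_n :=
  row i X - \sum_(j < n | (j < i)%N) dotr (row i X) (gs_row X j) *: gs_row X j.

Lemma gs_rec_fuel X (i : 'I_n) (m : nat) : (i < m)%N -> gs_rec X m i = gs_row X i.
Proof.
elim/ord_strong_ind: i m => i ih [//|m] im; rewrite /gs_row/=.
congr (unit_row (_ - _)); apply: eq_bigr => j ji.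
by rewrite !ih// (leq_trans ji).
Qed.

Lemma gs_rowE X i : gs_row X i = unit_row (gs_res X i).
Proof.
rewrite {1}/gs_row/=; congr (unit_row (_ - _)); apply: eq_bigr => j ji.
by rewrite gs_rec_fuel.
Qed.

(** The residual of row [i] is row [i] minus a combination of earlier rows; its
    coefficient vector [c] ends with a 1 in position [i]. This is what keeps the
    residual nonzero when the rows are independent. *)
Lemma gs_res_comb X i : exists2 c : 'rV[R]_n, gs_res X i = c *m X &
  c 0 i = 1 /\ forall j : 'I_n, (i < j)%N -> c 0 j = 0.
Proof.
elim/ord_strong_ind: i => i ih.
have /choice[c hc] (j : 'I_n) : exists c : 'rV[R]_n, (j < i)%N ->
    gs_row X j = c *m X /\ forall k : 'I_n, (j < k)%N -> c 0 k = 0.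
  have [ji|_] := boolP (j < i)%N; last by exists 0.
  have [c cE [_ c0]] := ih j ji.
  exists ((Num.sqrt (dotr (gs_res X j) (gs_res X j)))^-1 *: c) => _.
  rewrite gs_rowE /unit_row -scalemxAl -cE; split=> // k jk.
  by rewrite mxE c0// mulr0.
exists (delta_mx 0 i - \sum_(j < n | (j < i)%N) dotr (row i X) (gs_row X j) *: c j).
  rewrite mulmxBl -rowE mulmx_suml /gs_res; congr (_ - _).
  by apply: eq_bigr => j ji; rewrite -scalemxAl -(hc j ji).1.
split=> [|j ij]; rewrite !mxE summxE big1 ?subr0 ?eqxx//=.
- by move=> j ji; rewrite mxE (hc j ji).2// mulr0.
- by rewrite (gtn_eqF ij : j == i = false).
- by move=> k ki; rewrite mxE (hc k ki).2 ?mulr0// (ltn_trans ki).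
Qed.

Lemma gs_res_neq0 X i : X \in unitmx -> gs_res X i != 0.
Proof.
move=> Xu; have [c -> [ci _]] := gs_res_comb X i.
apply/eqP => h; have c0 : c = 0 by rewrite -[c](mulmxK Xu) h mul0mx.
by move: ci; rewrite c0 mxE => /eqP; rewrite eq_sym oner_eq0.
Qed.

Definition gs_norm X i : R := Num.sqrt (dotr (gs_res X i) (gs_res X i)).

Lemma gs_norm_gt0 X i : X \in unitmx -> 0 < gs_norm X i.
Proof. by move=> Xu; rewrite sqrtr_gt0 dotr_gt0// gs_res_neq0. Qed.

Lemma gs_resE X i : X \in unitmx -> gs_res X i = gs_norm X i *: gs_row X i.
Proof.
by move=> Xu; rewrite gs_rowE /unit_row scalerA divff ?scale1r// gt_eqF// gs_norm_gt0.
Qed.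

(** Each row only has to be compared with the earlier ones: in the residual, the
    projection on an earlier row has been removed, the earlier rows being
    orthonormal by induction. *)
Lemma gs_row_ortho X i j : X \in unitmx -> dotr (gs_row X i) (gs_row X j) = (i == j)%:R.
Proof.
move=> Xu.
have nrm k : dotr (gs_row X k) (gs_row X k) = 1.
  rewrite gs_rowE /unit_row dotrZl dotrZr mulrA -invfM -expr2 sqr_sqrtr ?dotr_ge0//.
  by rewrite mulVf// gt_eqF// dotr_gt0// gs_res_neq0.
have lt (k : 'I_n) : forall l : 'I_n, (l < k)%N -> dotr (gs_row X k) (gs_row X l) = 0.
  elim/ord_strong_ind: k => k ih l lk.
  rewrite gs_rowE /unit_row dotrZl; apply/eqP; rewrite mulf_eq0; apply/orP; right.
  rewrite /gs_res dotrDl dotrNl dotr_suml (bigD1 l)//= big1 => [|m /andP[mk ml]].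
    by rewrite dotrZl nrm mulr1 addr0 subrr.
  rewrite dotrZl; have [lm|lm|e] := ltngtP l m.
  - by rewrite ih// mulr0.
  - by rewrite [X in _ * X]dotrC ih// mulr0.
  - by move: ml; rewrite (val_inj e) eqxx.
have [ij|ij|e] := ltngtP i j; first by rewrite dotrC lt// (ltn_eqF ij : i == j = false).
- by rewrite lt// (gtn_eqF ij : i == j = false).
- by rewrite (val_inj e) nrm eqxx.
Qed.

Definition gs_mx X : 'M[R]_n := \matrix_i gs_row X i.

Lemma gs_mx_ortho X : X \in unitmx -> gs_mx X *m (gs_mx X)^T = 1%:M.
Proof.
by move=> Xu; apply/matrixP => i j; rewrite mulmx_trE !rowK gs_row_ortho// mxE.
Qed.

(** The factor [L] of the decomposition [X = L K], recovered from the orthogonal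
    factor [K] as [X K^T]. *)
Definition gs_tri X : 'M[R]_n := X *m (gs_mx X)^T.

Lemma gs_triE X i j : X \in unitmx ->
  gs_tri X i j = gs_norm X i * (i == j)%:R +
   \sum_(k < n | (k < i)%N) dotr (row i X) (gs_row X k) * (k == j)%:R.
Proof.
move=> Xu; rewrite mulmx_trE rowK.
have -> : row i X = gs_res X i +
  \sum_(k < n | (k < i)%N) dotr (row i X) (gs_row X k) *: gs_row X k.
  by rewrite subrK.
rewrite dotrDl gs_resE// dotrZl gs_row_ortho// dotr_suml; congr (_ + _).
apply: eq_bigr => k ki; rewrite dotrZl gs_row_ortho//; congr (_ * _).
by rewrite -gs_resE// subrK.
Qed.

Lemma gs_tri_gt0 X i : X \in unitmx -> 0 < gs_tri X i i.
Proof.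
move=> Xu; rewrite gs_triE// eqxx mulr1 big1 ?addr0 ?gs_norm_gt0// => k ki.
by rewrite (ltn_eqF ki : k == i = false) mulr0.
Qed.

Lemma gs_tri_upper X (i j : 'I_n) : X \in unitmx -> (i < j)%N -> gs_tri X i j = 0.
Proof.
move=> Xu ij; rewrite gs_triE// (ltn_eqF ij : i == j = false) mulr0 add0r big1// => k ki.
by rewrite (ltn_eqF (ltn_trans ki ij) : k == j = false) mulr0.
Qed.

Lemma gs_triK X : X \in unitmx -> gs_tri X *m gs_mx X = X.
Proof.
move=> Xu; rewrite /gs_tri -mulmxA (_ : _^T *m _ = 1%:M) ?mulmx1//.
exact/mulmx1C/gs_mx_ortho.
Qed.

Lemma gs_row_orthogonal X :
  (forall i j, i != j -> dotr (row i X) (row j X) = 0) ->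
  forall i, gs_row X i = unit_row (row i X).
Proof.
move=> h; elim/ord_strong_ind => i ih; rewrite gs_rowE /gs_res big1 ?subr0// => j ji.
by rewrite ih// /unit_row dotrZr (h i j) ?mulr0 ?scale0r// -val_eqE (gtn_eqF ji).
Qed.

Lemma gs_mx_orthogonal X : X *m X^T = 1%:M -> gs_mx X = X.
Proof.
move=> XX; have h i j : dotr (row i X) (row j X) = (i == j)%:R.
  by rewrite -mulmx_trE XX mxE.
apply/row_matrixP => i; rewrite rowK gs_row_orthogonal => [|k l kl].
  by rewrite /unit_row h eqxx sqrtr1 invr1 scale1r.
by rewrite h (negbTE kl).
Qed.

Lemma gs_mx_diag (d : 'rV[R]_n) : (forall i, 0 < d 0 i) -> gs_mx (diag_mx d) = 1%:M.
Proof.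
move=> d0.
have h i j : dotr (row i (diag_mx d)) (row j (diag_mx d)) = d 0 i ^+ 2 *+ (i == j).
  rewrite -mulmx_trE tr_diag_mx mulmx_diag !mxE -expr2//.
apply/row_matrixP => i; rewrite rowK gs_row_orthogonal => [|k l kl].
  rewrite /unit_row h eqxx mulr1n sqrtr_sqr gtr0_norm//.
  apply/rowP => j; rewrite !mxE; case: eqP => _; last by rewrite mulr0.
  by rewrite mulr1n mulVf// gt_eqF.
by rewrite h (negbTE kl).
Qed.

End GramSchmidt.

Section Infinitesimal.
Context {R : realType} {n : nat}.
Implicit Types A B L : 'M[R]_n.

(** Forward substitution: inverting a triangular matrix preserves triangularity,
    and inverts the diagonal entrywise. *)
Lemma tri_solve L A : (forall i j : 'I_n, (i < j)%N -> L i j = 0) ->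
  (forall i, 0 < L i i) ->
  (forall i j : 'I_n, (i < j)%N -> (L *m A) i j = 0) ->
  (forall i j : 'I_n, (i < j)%N -> A i j = 0) /\
  (forall i, A i i = (L *m A) i i / L i i).
Proof.
move=> Lu Ld LAu.
have Au : forall i j : 'I_n, (i < j)%N -> A i j = 0.
  elim/ord_strong_ind => i ih j ij; have := LAu i j ij.
  rewrite mxE (bigD1 i)//= big1 => [|k ki].
    by rewrite addr0 => /eqP; rewrite mulf_eq0 (gt_eqF (Ld i))/= => /eqP.
  have [ik|ik|e] := ltngtP i k; first by rewrite Lu// mul0r.
  - by rewrite ih ?mulr0// (ltn_trans ik).
  - by move: ki; rewrite (val_inj e) eqxx.
split=> // i; rewrite mxE (bigD1 i)//= big1 => [|k ki].
  by rewrite addr0 mulrC mulKf// gt_eqF.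
have [ik|ik|e] := ltngtP i k; first by rewrite Lu// mul0r.
- by rewrite Au// mulr0.
- by move: ki; rewrite (val_inj e) eqxx.
Qed.

Lemma sum_diag_upper (f : 'I_n -> 'I_n -> R) :
  \sum_i \sum_j f i j = \sum_i f i i +
    \sum_(i < n) \sum_(j < n | (i < j)%N) (f i j + f j i).
Proof.
under [X in _ + X]eq_bigr do rewrite big_split/=.
rewrite big_split/= [X in _ + (_ + X)](exchange_big_dep xpredT)//= -!big_split/=.
apply: eq_bigr => i _; rewrite (bigD1 i)//=; congr (_ + _).
rewrite (bigID (fun j : 'I_n => (i < j)%N))/=; congr (_ + _); apply: eq_bigl => j.
  by case: ltngtP; rewrite ?andbF// andbT => ij; rewrite ?(gtn_eqF ij : (j == i) = false).
have [ij|ij|/val_inj ->] := ltngtP i j; rewrite ?andbF ?eqxx ?ltnn//.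
by rewrite (ltn_eqF ij : (j == i) = false).
Qed.

(** The key inequality. Write [Om] for [dK K^T]; it is skew because [K] stays
    orthogonal. Conjugating the body velocity [X^-1 dX] by [K] yields [Z] of the
    same norm, and [L (Z - Om) = dL], so that [Z - Om] is lower triangular. Hence
    the diagonal of [Z] is that of [L^-1 dL], and above the diagonal [Z] agrees
    with [Om], whose upper half carries half of the squared norm of [dK]. *)
Lemma frame_velocity (X dX K dK L dL : 'M[R]_n) :
  X \in unitmx -> K *m K^T = 1%:M -> X = L *m K ->
  dX = dL *m K + L *m dK ->
  dK *m K^T + K *m dK^T = 0 ->
  (forall i j : 'I_n, (i < j)%N -> L i j = 0) -> (forall i, 0 < L i i) ->
  (forall i j : 'I_n, (i < j)%N -> dL i j = 0) ->
  let Z := K *m (invmx X *m dX) *m K^T in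
  (forall i, Z i i = dL i i / L i i) /\
  \sum_i (dL i i / L i i) ^+ 2 + 2^-1 * \sum_i \sum_j dK i j ^+ 2
    <= frob2 (invmx X *m dX).
Proof.
move=> Xu KK XE dXE skew Lu Ld dLu Z.
have KK' : K^T *m K = 1%:M by exact: mulmx1C.
set Om := dK *m K^T in skew *.
have OmT : Om^T = - Om.
  by apply/eqP; rewrite -addr_eq0 addrC trmx_mul trmxK skew.
have Oma i j : Om j i = - Om i j by have /matrixP/(_ i j) := OmT; rewrite [LHS]mxE [RHS]mxE.
have Omd i : Om i i = 0 by have := Oma i i; lra.
have LZ : L *m (Z - Om) = dL.
  rewrite mulmxBr /Z !mulmxA -XE mulmxV// mul1mx dXE mulmxDl -!mulmxA KK mulmx1.
  by rewrite addrK.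
have [Zu Zd] := @tri_solve L (Z - Om) Lu Ld ltac:(by move=> i j ij; rewrite LZ dLu).
have Zii i : Z i i = dL i i / L i i.
  by rewrite -LZ -Zd [RHS]mxE [X in _ + X]mxE Omd oppr0 addr0.
have Zij (i j : 'I_n) : (i < j)%N -> Z i j = Om i j.
  by move=> /Zu; rewrite !mxE => /eqP; rewrite subr_eq0 => /eqP.
split=> //.
rewrite -(frob2_conj _ KK) -/Z frob2E.
have <- : \sum_i \sum_j Om i j ^+ 2 = \sum_i \sum_j dK i j ^+ 2.
  by rewrite -!frob2E frob2_mulr.
rewrite !sum_diag_upper [\sum_i Om i i ^+ 2]big1 ?add0r => [|i _]; last by rewrite Omd expr0n.
rewrite lerD// ?mulr_sumr; first by apply: ler_sum => i _; rewrite Zii.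
apply: ler_sum => i _; rewrite mulr_sumr; apply: ler_sum => j ij.
rewrite Zij// (Oma i j) sqrrN.
by move: (sqr_ge0 (Z j i)) => h; lra.
Qed.

End Infinitesimal.

(** * Differential calculus of matrix-valued curves *)

Section ScalarCurves.
Context {R : realType}.
Implicit Types (f g : R -> R) (t : R).

Lemma is_derive_fD f g t df dg : is_derive t 1 f df -> is_derive t 1 g dg ->
  is_derive t 1 (fun s => f s + g s) (df + dg).
Proof. exact: is_deriveD. Qed.

Lemma is_derive_fM f g t df dg : is_derive t 1 f df -> is_derive t 1 g dg ->
  is_derive t 1 (fun s => f s * g s) (df * g t + f t * dg).
Proof.
by move=> hf hg; apply: is_derive_eq (is_deriveM hf hg) _; rewrite addrC mulrC.
Qed.

Lemma is_derive_fN f t df : is_derive t 1 f df -> is_derive t 1 (fun s => - f s) (- df).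
Proof. exact: is_deriveN. Qed.

Lemma is_derive_f_cst c t : is_derive t 1 (fun=> c : R) 0.
Proof. exact: is_derive_cst. Qed.

Lemma is_derive_fsum (I : Type) (r : seq I) (P : pred I) (f : I -> R -> R) df t :
  (forall i, is_derive t 1 (f i) (df i)) ->
  is_derive t 1 (fun s => \sum_(i <- r | P i) f i s) (\sum_(i <- r | P i) df i).
Proof.
move=> h; elim: r => [|i r ih].
  rewrite big_nil (_ : (fun _ => _) = fun=> 0); first exact: is_derive_cst.
  by apply/funext => s; rewrite big_nil.
rewrite big_cons (_ : (fun _ => _) = fun s =>
    if P i then f i s + \sum_(i <- r | P i) f i s else \sum_(i <- r | P i) f i s).
  by case: (P i) => //; exact: is_derive_fD.
by apply/funext => s; rewrite big_cons.
Qed.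

Lemma derivable_fsum (I : Type) (r : seq I) (P : pred I) (f : I -> R -> R) t :
  (forall i, P i -> derivable (f i) t 1) ->
  derivable (fun s => \sum_(i <- r | P i) f i s) t 1.
Proof.
move=> h; elim: r => [|i r ih].
  rewrite (_ : (fun _ => _) = fun=> 0); first exact: derivable_cst.
  by apply/funext => s; rewrite big_nil.
rewrite (_ : (fun _ => _) = fun s =>
    if P i then f i s + \sum_(i <- r | P i) f i s else \sum_(i <- r | P i) f i s).
  by have [Pi|_] := boolP (P i); [apply: derivableD; [exact: h|exact: ih]|exact: ih].
by apply/funext => s; rewrite big_cons.
Qed.

Lemma derivable_fprod (I : Type) (r : seq I) (f : I -> R -> R) t :
  (forall i, derivable (f i) t 1) ->
  derivable (fun s => \prod_(i <- r) f i s) t 1.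
Proof.
move=> h; elim: r => [|i r ih].
  rewrite (_ : (fun _ => _) = fun=> 1); first exact: derivable_cst.
  by apply/funext => s; rewrite big_nil.
rewrite (_ : (fun _ => _) = fun s => f i s * \prod_(i <- r) f i s).
  exact: derivableM (h i) ih.
by apply/funext => s; rewrite big_cons.
Qed.

Lemma continuous_fsum (I : Type) (r : seq I) (P : pred I) (f : I -> R -> R) t :
  (forall i, {for t, continuous (f i)}) ->
  {for t, continuous (fun s => \sum_(i <- r | P i) f i s)}.
Proof.
move=> h; elim: r => [|i r ih].
  rewrite (_ : (fun _ => _) = fun=> 0); first exact: cst_continuous.
  by apply/funext => s; rewrite big_nil.
rewrite (_ : (fun _ => _) = fun s =>
    if P i then f i s + \sum_(i <- r | P i) f i s else \sum_(i <- r | P i) f i s).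
  by case: (P i) => //; apply: continuousD.
by apply/funext => s; rewrite big_cons.
Qed.

Lemma derivable_continuous f t : derivable f t 1 -> {for t, continuous f}.
Proof. by move=> /derivable1_diffP/differentiable_continuous. Qed.

Lemma derivable_sqrt f t : 0 < f t -> derivable f t 1 ->
  derivable (fun s => Num.sqrt (f s)) t 1.
Proof.
by move=> f0 /derivableP df; have [] := is_derive1_comp (is_derive1_sqrt f0) df.
Qed.

End ScalarCurves.

Section MatrixCurves.
Context {R : realType}.
Implicit Types t : R.

Lemma is_derive_mxP m n (M : R -> 'M[R]_(m, n)) t dM :
  is_derive t 1 M dM <-> forall i j, is_derive t 1 (fun s => M s i j) (dM i j).
Proof.
split=> [[dv <-] i j|h].
  rewrite derive_mx// mxE; apply: derivableP.
  by move/derivable_mxP : dv.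
have dv : derivable M t 1 by apply/derivable_mxP => i j; have [] := h i j.
split=> //; rewrite derive_mx//; apply/matrixP => i j; rewrite mxE.
by have [] := h i j.
Qed.

Lemma is_derive_mulmx m n p (M : R -> 'M[R]_(m, n)) (N : R -> 'M[R]_(n, p)) t dM dN :
  is_derive t 1 M dM -> is_derive t 1 N dN ->
  is_derive t 1 (fun s => M s *m N s) (dM *m N t + M t *m dN).
Proof.
move=> /is_derive_mxP hM /is_derive_mxP hN; apply/is_derive_mxP => i j.
rewrite (_ : (fun _ => _) = fun s => \sum_k M s i k * N s k j); last first.
  by apply/funext => s; rewrite mxE.
rewrite !mxE -big_split; apply: is_derive_fsum => k.
exact: is_derive_fM.
Qed.

Lemma is_derive_trmx m n (M : R -> 'M[R]_(m, n)) t dM :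
  is_derive t 1 M dM -> is_derive t 1 (fun s => (M s)^T) dM^T.
Proof.
move=> /is_derive_mxP hM; apply/is_derive_mxP => i j; rewrite mxE.
rewrite (_ : (fun _ => _) = fun s => M s j i); first exact: hM.
by apply/funext => s; rewrite mxE.
Qed.

Lemma is_derive_mxtrace n (M : R -> 'M[R]_n) t dM :
  is_derive t 1 M dM -> is_derive t 1 (fun s => \tr (M s)) (\tr dM).
Proof. by move=> /is_derive_mxP hM; apply: is_derive_fsum => i; exact: hM. Qed.

Lemma derivable_det n (M : R -> 'M[R]_n) t :
  (forall i j, derivable (fun s => M s i j) t 1) ->
  derivable (fun s => \det (M s)) t 1.
Proof.
move=> h; apply: derivable_fsum => s _; apply: derivableM; first exact: derivable_cst.
by apply: derivable_fprod => i; exact: h.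
Qed.

Lemma near_det_gt0 n (M : R -> 'M[R]_n) t : derivable M t 1 -> 0 < \det (M t) ->
  \forall s \near t, 0 < \det (M s).
Proof.
move=> /derivable_mxP/derivable_det/derivable_continuous dM M0.
by apply: (dM [set x | 0 < x]); exact: lt_nbhsr.
Qed.

Lemma det_gt0_unit n (A : 'M[R]_n) : 0 < \det A -> A \in unitmx.
Proof. by move=> A0; rewrite unitmxE unitfE gt_eqF. Qed.

(** Cramer's rule is valid on a neighbourhood of [t] only, since [invmx] is the
    identity on singular matrices. *)
Lemma derivable_invmx n (M : R -> 'M[R]_n) t : derivable M t 1 -> 0 < \det (M t) ->
  derivable (fun s => invmx (M s)) t 1.
Proof.
move=> dM M0; have /derivable_mxP dMij := dM.
have dN : derivable (fun s => (\det (M s))^-1 *: \adj (M s)) t 1.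
  apply/derivable_mxP => i j.
  rewrite (_ : (fun _ => _) = fun s => (\det (M s))^-1 * cofactor (M s) j i); last first.
    by apply/funext => s; rewrite !mxE.
  apply: derivableM.
    by apply: derivableV; [rewrite gt_eqF|exact: derivable_det].
  apply: derivableM; first exact: derivable_cst.
  apply: derivable_det => k l.
  rewrite (_ : (fun _ => _) = fun s => M s (lift j k) (lift i l)); first exact: dMij.
  by apply/funext => s; rewrite !mxE.
apply: near_eq_derivable dN.
apply: filterS (near_det_gt0 dM M0) => s s0.
by rewrite /invmx det_gt0_unit.
Qed.

(** Differentiability comes from the adjugate formula; the value is then forced
    by differentiating [M M^-1 = 1]. *)
Lemma is_derive_invmx n (M : R -> 'M[R]_n) t dM : is_derive t 1 M dM -> 0 < \det (M t) ->
  is_derive t 1 (fun s => invmx (M s)) (- (invmx (M t) *m dM *m invmx (M t))).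
Proof.
move=> hM M0; have [dv _] := hM.
have hI := derivableP (derivable_invmx dv M0).
have h1 := is_derive_mulmx hM hI.
have h2 : is_derive t 1 (fun s => M s *m invmx (M s)) 0.
  apply: (@near_eq_is_derive _ _ _ (cst 1%:M)).
  by apply: filterS (near_det_gt0 dv M0) => s s0; rewrite mulmxV// det_gt0_unit.
have /eqP : dM *m invmx (M t) + M t *m 'D_1 (fun s => invmx (M s)) t = 0.
  by have [_ <-] := h1; have [_ <-] := h2.
rewrite addrC addr_eq0 => /eqP e; apply: is_derive_eq hI _.
rewrite -[LHS](mulKmx (det_gt0_unit M0)) e.
by rewrite mulmxN mulmxA.
Qed.

Lemma is_derive_metric n (M X Y : R -> 'M[R]_n) t dM dX dY :
  is_derive t 1 M dM -> is_derive t 1 X dX -> is_derive t 1 Y dY -> 0 < \det (M t) ->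
  let iM := invmx (M t) in
  is_derive t 1 (fun s => metric (M s) (X s) (Y s))
    (\tr ((iM *m dX - iM *m dM *m iM *m X t)^T *m (iM *m Y t)) +
     \tr ((iM *m X t)^T *m (iM *m dY - iM *m dM *m iM *m Y t))).
Proof.
move=> hM hX hY M0 iM; have hI := is_derive_invmx hM M0.
have h Z dZ : is_derive t 1 Z dZ -> is_derive t 1 (fun s => invmx (M s) *m Z s)
    (iM *m dZ - iM *m dM *m iM *m Z t).
  by move=> hZ; apply: is_derive_eq (is_derive_mulmx hI hZ) _; rewrite addrC mulNmx.
rewrite -raddfD; apply: is_derive_mxtrace; apply: is_derive_mulmx.
by apply: is_derive_trmx; exact: h.
Qed.

Lemma continuous_metric n (M X : R -> 'M[R]_n) t : derivable M t 1 -> 0 < \det (M t) ->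
  {for t, continuous X} -> {for t, continuous (fun s => metric (M s) (X s) (X s))}.
Proof.
move=> dM M0 cX; have /derivable_mxP dI := derivable_invmx dM M0.
have cIX i j : {for t, continuous (fun s => (invmx (M s) *m X s) i j)}.
  rewrite (_ : (fun _ => _) = fun s => \sum_k invmx (M s) i k * X s k j); last first.
    by apply/funext => s; rewrite mxE.
  apply: continuous_fsum => k; apply: continuousM.
    exact: derivable_continuous (dI i k).
  by apply: (@continuous_comp _ _ _ X (fun A : 'M[R]_n => A k j)) => //; exact: coord_continuous.
rewrite (_ : (fun _ => _) = fun s =>
    \sum_i \sum_j (invmx (M s) *m X s) j i * (invmx (M s) *m X s) j i); last first.
  apply/funext => s; apply: eq_bigr => i _; rewrite mxE; apply: eq_bigr => j _.
  by rewrite mxE.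
by do 2!apply: continuous_fsum => ?; apply: continuousM.
Qed.

End MatrixCurves.

(** * The orthonormalization along a curve *)

Section GramSchmidtCurves.
Context {R : realType} {n : nat}.
Implicit Types (X : R -> 'M[R]_n) (t : R).

Lemma derivable_dotr (x y : R -> 'rV[R]_n) t :
  (forall j, derivable (fun s => x s 0 j) t 1) ->
  (forall j, derivable (fun s => y s 0 j) t 1) ->
  derivable (fun s => dotr (x s) (y s)) t 1.
Proof. by move=> hx hy; apply: derivable_fsum => j _; exact: derivableM. Qed.

Lemma derivable_gs_row X t i j : derivable X t 1 -> 0 < \det (X t) ->
  derivable (fun s => gs_row (X s) i 0 j) t 1.
Proof.
move=> /derivable_mxP dX X0; elim/ord_strong_ind: i j => i ih.
have drow k j : derivable (fun s => row k (X s) 0 j) t 1.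
  rewrite (_ : (fun _ => _) = fun s => X s k j); first exact: dX.
  by apply/funext => s; rewrite mxE.
have dres j : derivable (fun s => gs_res (X s) i 0 j) t 1.
  rewrite (_ : (fun _ => _) = fun s => row i (X s) 0 j -
      \sum_(k < n | (k < i)%N)
        dotr (row i (X s)) (gs_row (X s) k) * gs_row (X s) k 0 j); last first.
    apply/funext => s; rewrite !mxE summxE; congr (_ - _).
    by apply: eq_bigr => k _; rewrite mxE.
  apply: derivableB; first exact: drow.
  apply: derivable_fsum => k ki; apply: derivableM; last exact: ih.
  by apply: derivable_dotr => l; [exact: drow|exact: ih].
move=> j; rewrite (_ : (fun _ => _) = fun s =>
    (Num.sqrt (dotr (gs_res (X s) i) (gs_res (X s) i)))^-1 * gs_res (X s) i 0 j).
  apply: derivableM => //; apply: derivableV.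
    by rewrite gt_eqF// gs_norm_gt0// det_gt0_unit.
  apply: derivable_sqrt; last exact: derivable_dotr.
  by rewrite dotr_gt0// gs_res_neq0// det_gt0_unit.
by apply/funext => s; rewrite gs_rowE mxE.
Qed.

Lemma derivable_gs_mx X t : derivable X t 1 -> 0 < \det (X t) ->
  derivable (fun s => gs_mx (X s)) t 1.
Proof.
move=> dX X0; apply/derivable_mxP => i j.
rewrite (_ : (fun _ => _) = fun s => gs_row (X s) i 0 j).
  exact: derivable_gs_row.
by apply/funext => s; rewrite mxE.
Qed.

(** All the relations that [frame_velocity] needs are derivatives of identities
    valid near [t], where the matrix stays invertible. *)
Lemma gs_velocity X t dX : is_derive t 1 X dX -> 0 < \det (X t) ->
  exists dK dL : 'M[R]_n, let K := gs_mx (X t) in let L := gs_tri (X t) in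
  let Z := K *m (invmx (X t) *m dX) *m K^T in
  [/\ is_derive t 1 (fun s => gs_mx (X s)) dK,
      is_derive t 1 (fun s => gs_tri (X s)) dL,
      forall i, Z i i = dL i i / L i i &
      \sum_i (dL i i / L i i) ^+ 2 + 2^-1 * \sum_i \sum_j dK i j ^+ 2
        <= frob2 (invmx (X t) *m dX)].
Proof.
move=> hX X0; have [dv _] := hX; have Xu := det_gt0_unit X0.
have hK := derivableP (derivable_gs_mx dv X0).
set dK := 'D_1 _ t in hK.
have hKT := is_derive_trmx hK.
have hL := is_derive_mulmx hX hKT.
set dL := (X in is_derive _ _ _ X) in hL.
have nearu : \forall s \near t, X s \in unitmx.
  by apply: filterS (near_det_gt0 dv X0) => s; exact: det_gt0_unit.
exists dK, dL => K L Z.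
have h1 : dX = dL *m K + L *m dK.
  have h := is_derive_mulmx hL hK.
  have [_ <-] := hX; have [_ <-] := h.
  apply: near_eq_derive; apply: filterS nearu => s su.
  by rewrite -[LHS](gs_triK su).
have h2 : dK *m K^T + K *m dK^T = 0.
  have h := is_derive_mulmx hK hKT; have [_ <-] := h.
  transitivity ('D_1 (cst (1%:M : 'M[R]_n)) t); last exact: derive_cst.
  apply: near_eq_derive; apply: filterS nearu => s su.
  exact: gs_mx_ortho.
have h3 : forall i j : 'I_n, (i < j)%N -> dL i j = 0.
  move=> i j ij; have /is_derive_mxP/(_ i j)[_ <-] := hL.
  transitivity ('D_1 (cst (0 : R)) t); last exact: derive_cst.
  apply: near_eq_derive; apply: filterS nearu => s su.
  exact: gs_tri_upper.
have [] := @frame_velocity R n (X t) dX K dK L dL Xu (gs_mx_ortho Xu) _ h1 h2 _ _ h3.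
- by rewrite gs_triK.
- by move=> i j; exact: gs_tri_upper.
- by move=> i; exact: gs_tri_gt0.
by move=> a b; split.
Qed.

End GramSchmidtCurves.

(** * A 1-Lipschitz map from the group to a Euclidean space *)

Section Chart.
Context {R : realType} {n : nat}.
Implicit Types (A B : 'M[R]_n) (X : R -> 'M[R]_n) (t : R).

Definition coord_index : Type := ('I_n + 'I_n * 'I_n)%type.

(** The factor [1 / sqrt 2] on the orthogonal part is the largest one for which
    [frame_velocity] makes this map 1-Lipschitz. *)
Definition chart A (k : coord_index) : R :=
  match k with
  | inl i => ln (gs_tri A i i)
  | inr p => gs_mx A p.1 p.2 / Num.sqrt 2
  end.

Lemma sum_coord (f : coord_index -> R) :
  \sum_k f k = \sum_i f (inl i) + \sum_i \sum_j f (inr (i, j)).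
Proof. by rewrite big_sumType/= pair_big; congr (_ + _); apply: eq_bigr => -[]. Qed.

Lemma chart_velocity X t dX : is_derive t 1 X dX -> 0 < \det (X t) ->
  exists2 dF : coord_index -> R,
    forall k, is_derive t 1 (fun s => chart (X s) k) (dF k) &
    \sum_k dF k ^+ 2 <= metric (X t) dX dX.
Proof.
move=> hX X0; have [dK [dL [hK hL _ le]]] := gs_velocity hX X0.
exists (fun k => match k with
  | inl i => dL i i / gs_tri (X t) i i | inr p => dK p.1 p.2 / Num.sqrt 2 end).
  case=> [i|[i j]]/=.
    have /is_derive_mxP/(_ i i) hLi := hL.
    have h := is_derive1_comp (is_derive1_ln (gs_tri_gt0 i (det_gt0_unit X0))) hLi.
    by apply: is_derive_eq h _; rewrite mulrC.
  have /is_derive_mxP/(_ i j) hKij := hK.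
  by apply: is_derive_eq (is_derive_fM hKij (is_derive_f_cst _ _)) _; rewrite mulr0 addr0.
apply: le_trans le; rewrite sum_coord/= lerD2l mulr_sumr; apply: ler_sum => i _.
rewrite mulr_sumr; apply: ler_sum => j _.
by rewrite expr_div_n sqr_sqrtr// mulrC.
Qed.

(** Testing the chart against a fixed vector reduces the comparison of lengths
    to real-valued functions. *)
Definition pairing (v : coord_index -> R) A : R := \sum_k v k * chart A k.

Lemma pairing_velocity v X t : derivable X t 1 -> 0 < \det (X t) ->
  derivable (fun s => pairing v (X s)) t 1 /\
  derive1 (fun s => pairing v (X s)) t <=
    norm2 v * Num.sqrt (metric (X t) (derive1 X t) (derive1 X t)).
Proof.
move=> dX X0; have hX := derivableP dX; have [dF hF le] := chart_velocity hX X0.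
have hvF k : is_derive t 1 (fun s => v k * chart (X s) k) (v k * dF k).
  by apply: is_derive_eq (is_derive_fM (is_derive_f_cst _ _) (hF k)) _; rewrite mul0r add0r.
have [dv e] : is_derive t 1 (fun s => pairing v (X s)) (\sum_k v k * dF k).
  exact: is_derive_fsum.
split=> //; rewrite !derive1E e; apply: le_trans (cauchy_schwarz _ _) _.
by rewrite ler_wpM2l ?norm2_ge0// ler_wsqrtr.
Qed.

End Chart.

(** * Length of piecewise smooth curves *)

Section Increment.
Context {R : realType}.
Notation mu := (@lebesgue_measure R).

(** The derivative of [h] need not be continuous, so [h] is compared with the
    primitive of [f] by monotonicity instead of being integrated. *)
Lemma increment_le_integral (f h : R -> R) (C a b : R) : a < b ->
  {in `[a, b]%R, forall x, {for x, continuous f}} ->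
  {in `[a, b]%R, forall x, derivable h x 1} ->
  {in `]a, b[%R, forall x, derive1 h x <= C * f x} ->
  ((h b - h a)%:E <= C%:E * \int[mu]_(x in `[a, b]) (f x)%:E)%E.
Proof.
move=> ab cf dh hle.
have fi : mu.-integrable `[a, b] (EFin \o f).
  apply: continuous_compact_integrable; first exact: segment_compact.
  by apply: continuous_in_subspaceT => x /set_mem; exact: cf.
set G := fun x => parameterized_integral mu a x f.
have dG x : x \in `]a, b[%R -> derivable G x 1 /\ derive1 G x = f x.
  move=> xab; have := xab; rewrite in_itv/= => /andP[ax xb].
  apply: (continuous_FTC1_closed xb fi ax).
  by apply: cf; exact: subset_itv_oo_cc.
have cG : {within `[a, b], continuous G}.
  exact: parameterized_integral_continuous (ltW ab) fi.
set g := fun x => C * G x - h x.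
have hg x : x \in `]a, b[%R -> is_derive x 1 g (C * f x - derive1 h x).
  move=> xab; have [dGx eG] := dG x xab.
  have hh : is_derive x 1 h (derive1 h x).
    by rewrite derive1E; apply/derivableP/dh/subset_itv_oo_cc.
  have hG : is_derive x 1 G (f x) by rewrite -eG derive1E; exact: derivableP.
  apply: is_derive_eq (is_derive_fD (is_derive_fM (is_derive_f_cst C x) hG)
    (is_derive_fN hh)) _.
  by rewrite mul0r add0r.
have /(_ a b) : {in `[a, b]%R &, {homo g : x y / x <= y}}.
  apply: ger0_derive1_le_cc.
  - by move=> x /hg[].
  - by move=> x xab; have [_ eg] := hg x xab; rewrite [derive1 g x]derive1E eg subr_ge0 hle.
  - move=> x; apply: (@continuousB _ R^o (subspace `[a, b]) (fun x => C * G x) h).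
      by apply: (@continuousM _ (subspace `[a, b]) (cst C) G); [exact: cst_continuous|exact: cG].
    exact: derivable_within_continuous.
rewrite !in_itv/= !lexx (ltW ab)/= => /(_ isT isT isT).
rewrite /g {1}/G /parameterized_integral set_itv1 Rintegral_set1 mulr0 sub0r => le.
rewrite -(@fineK _ (\int[mu]_(x in `[a, b]) (f x)%:E)%E); last first.
  by apply: (integrable_fin_num _ fi).
rewrite -EFinM lee_fin -[X in _ <= C * X]/(G b).
by lra.
Qed.

End Increment.

Section Length.
Context {R : realType} {n : nat}.
Notation mu := (@lebesgue_measure R).
Implicit Types (gamma sigma : R -> 'M[R]_n) (v : @coord_index n -> R).

Lemma speed_eq_near gamma sigma t : {near t, gamma =1 sigma} ->
  speed gamma t = speed sigma t.
Proof.
move=> e; rewrite /speed !derive1E (near_eq_derive (1 : R) e).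
by rewrite (nbhs_singleton e).
Qed.

(** At the ends of the interval the two curves may differ nearby, which is why
    derivatives are compared in the interior only. *)
Lemma eq_itv_near gamma sigma (a b : R) : {in `[a, b]%R, gamma =1 sigma} ->
  {in `]a, b[%R, forall t, {near t, gamma =1 sigma}}.
Proof.
move=> e t tab; apply: filterS (near_in_itvoo tab) => s sab.
by apply: e; exact: subset_itv_oo_cc.
Qed.

Lemma continuous_speed sigma t : derivable sigma t 1 -> 0 < \det (sigma t) ->
  {for t, continuous (derive1 sigma)} -> {for t, continuous (speed sigma)}.
Proof.
move=> ds s0 cs; apply: (@continuous_comp _ _ _ _ (@Num.sqrt R)); last exact: sqrt_continuous.
exact: continuous_metric.
Qed.

Lemma piece_length gamma v (a b : R) : a < b -> Ck_on 1 a b gamma ->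
  {in `[a, b]%R, forall t, 0 < \det (gamma t)} ->
  measurable_fun `[a, b] (speed gamma) /\
  ((pairing v (gamma b) - pairing v (gamma a))%:E <=
    (norm2 v)%:E * \int[mu]_(t in `[a, b]) (speed gamma t)%:E)%E.
Proof.
move=> ab [sigma [ds cs] e] det0.
have {}ds t : derivable sigma t 1 by exact: (ds 0%N).
have {}cs : continuous (derive1 sigma) by exact: (cs 1%N).
have sdet0 : {in `[a, b]%R, forall t, 0 < \det (sigma t)}.
  by move=> t tab; rewrite -e// det0.
have cspeed : {in `[a, b]%R, forall t, {for t, continuous (speed sigma)}}.
  by move=> t tab; apply: continuous_speed; [|exact: sdet0|exact: cs].
have es : {in `]a, b[%R, speed gamma =1 speed sigma}.
  by move=> t tab; exact/speed_eq_near/(eq_itv_near e).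
have ms : measurable_fun `]a, b[ (speed sigma).
  apply: measurable_realfun.subspace_continuous_measurable_fun => //.
  by apply: continuous_in_subspaceT => x /set_mem xab; apply: cspeed; exact: subset_itv_oo_cc.
have mg : measurable_fun `]a, b[ (speed gamma).
  by apply: eq_measurable_fun ms => x /set_mem xab; rewrite es.
split.
  exact: (@measurable_realfun.measurable_fun_itv_cc _ _ _ false true).
rewrite (eq_integral_itv_bounded _ _ mg ms es).
rewrite !e ?in_itv/= ?lexx ?(ltW ab)//.
apply: (@increment_le_integral _ _ (fun t => pairing v (sigma t))) => //.
- by move=> t tab; have [] := pairing_velocity v (ds t) (sdet0 t tab).
- move=> t tab; have tab' := subset_itv_oo_cc tab.
  by have [] := pairing_velocity v (ds t) (sdet0 t tab').
Qed.

(** Adding up the pieces needs the speed to be measurable on the whole interval;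
    the break points are harmless because they are null sets. *)
Lemma path_length gamma v (s : seq R) (a : R) : path <%R a s ->
  (forall i, (i < size s)%N ->
     Ck_on 1 (nth 0 (a :: s) i) (nth 0 (a :: s) i.+1) gamma) ->
  {in `[a, last a s]%R, forall t, 0 < \det (gamma t)} ->
  a <= last a s /\
  measurable_fun `[a, last a s] (speed gamma) /\
  ((pairing v (gamma (last a s)) - pairing v (gamma a))%:E <=
    (norm2 v)%:E * \int[mu]_(t in `[a, last a s]) (speed gamma t)%:E)%E.
Proof.
elim: s a => [|b s ih] a /=.
  move=> _ _ _; rewrite lexx subrr set_itv1 integral_set1 mule0; split=> //.
  by split; first exact: measurable_fun_set1.
move=> /andP[ab pb] hCk det0.
have [bl [mb le2]] : b <= last b s /\
  measurable_fun `[b, last b s] (speed gamma) /\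
  ((pairing v (gamma (last b s)) - pairing v (gamma b))%:E <=
    (norm2 v)%:E * \int[mu]_(t in `[b, last b s]) (speed gamma t)%:E)%E.
  apply: ih => // [i il|t]; first exact: (hCk i.+1).
  rewrite in_itv/= => /andP[bt tl]; apply: det0.
  by rewrite in_itv/= tl (le_trans (ltW ab)).
have [ma le1] : measurable_fun `[a, b] (speed gamma) /\
  ((pairing v (gamma b) - pairing v (gamma a))%:E <=
    (norm2 v)%:E * \int[mu]_(t in `[a, b]) (speed gamma t)%:E)%E.
  apply: piece_length => //; first exact: (hCk 0%N).
  move=> t; rewrite in_itv/= => /andP[at' tb]; apply: det0.
  by rewrite in_itv/= at' (le_trans tb).
have al : a <= last b s by rewrite (le_trans (ltW ab)).
have ma' : measurable_fun `[a, b[ (speed gamma).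
  by apply: measurable_funS ma => //; exact: subset_itv_co_cc.
have U : `[a, last b s] = `[a, b[ `|` `[b, last b s] :> set R.
  by apply: itv_bndbnd_setU; rewrite bnd_simp // ltW.
have mU : measurable_fun (`[a, b[ `|` `[b, last b s]) (speed gamma).
  by apply/measurable_funU => //; split.
split; [exact: al|rewrite U; split; first exact: mU].
rewrite ge0_integral_setU//=; last 3 first.
- exact/measurable_realfun.measurable_EFinP.
- by move=> x _; rewrite lee_fin sqrtr_ge0.
- apply/disj_setPS => x [/=]; rewrite !in_itv/= => /andP[_ xb] /andP[bx _].
  by move: (lt_le_trans xb bx); rewrite ltxx.
rewrite integral_itv_bndo_bndc; last exact/measurable_realfun.measurable_EFinP.
rewrite ge0_muleDr; last 2 first.
- by apply: integral_ge0 => x _; rewrite lee_fin sqrtr_ge0.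
- by apply: integral_ge0 => x _; rewrite lee_fin sqrtr_ge0.
apply: le_trans (leeD le1 le2); rewrite -EFinD lee_fin.
by lra.
Qed.

(** The chart is tested against its own increment. *)
Lemma curve_length_ge gamma (A B : 'M[R]_n) (v := fun k => chart B k - chart A k) :
  piecewise_C1 gamma -> joins A B gamma -> ((norm2 v)%:E <= curve_length gamma)%E.
Proof.
move=> [s [ps ls hs]] [g0 g1 gl].
have gl' : {in `[0, last 0 s]%R, forall t, 0 < \det (gamma t)} by rewrite ls.
have [_ [_ le]] := path_length v ps hs gl'.
rewrite ls g0 g1 -/(curve_length gamma) in le.
have l0 : (0 <= curve_length gamma)%E.
  by apply: integral_ge0 => x _; rewrite lee_fin sqrtr_ge0.
have e : pairing v B - pairing v A = norm2 v ^+ 2.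
  rewrite sqr_norm2 /pairing -sumrB; apply: eq_bigr => k _.
  by rewrite -mulrBr expr2.
rewrite e expr2 EFinM in le.
have [v0|v0] := eqVneq (norm2 v) 0; first by rewrite v0.
by rewrite -(@lee_pmul2l _ (norm2 v)%:E)// lte_fin lt_neqAle eq_sym v0 norm2_ge0.
Qed.

Lemma rdist_ge (A B : 'M[R]_n) : ((norm2 (fun k => chart B k - chart A k))%:E <= rdist A B)%E.
Proof.
apply: le_ereal_inf_tmp => _ [gamma [h1 h2] <-].
exact: curve_length_ge.
Qed.

End Length.

(** * The Christoffel symbols of the left-invariant metric *)

Section Christoffel.
Context {R : realType} {n : nat}.
Implicit Types A X Y Z : 'M[R]_n.

(** Turns a directional derivative on the space of matrices into the derivative
    of a curve. *)
Lemma derive_along_line (f : 'M[R]_n -> R) A X :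
  'D_X f A = 'D_1 (fun h : R => f (h *: X + A)) 0.
Proof.
rewrite /derive; set g1 := fun h => h^-1 *: _; set g2 := fun h => h^-1 *: _.
suff -> : g1 = g2 by []; apply/funext => h; rewrite /g1 /g2 /=.
by rewrite [h *: 1]mulr1 addr0 scale0r add0r.
Qed.

Lemma derive_metric A X Y Z : 0 < \det A ->
  'D_X (fun P => metric P Y Z) A =
   - \tr ((invmx A *m X *m invmx A *m Y)^T *m (invmx A *m Z))
   - \tr ((invmx A *m Y)^T *m (invmx A *m X *m invmx A *m Z)).
Proof.
move=> A0; rewrite derive_along_line.
have hl : is_derive (0 : R) 1 (fun h : R => h *: X + A) X.
  apply/is_derive_mxP => i j.
  rewrite (_ : (fun _ => _) = fun h : R => h * X i j + A i j); last first.
    by apply/funext => h; rewrite !mxE.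
  have h := is_derive_fD (is_derive_fM (is_derive_id (0 : R) 1) (is_derive_f_cst (X i j) _))
    (is_derive_f_cst (A i j) _).
  by apply: is_derive_eq h _; rewrite mul1r mulr0 !addr0.
have A0' : 0 < \det (0 *: X + A) by rewrite scale0r add0r.
have hc (C : 'M[R]_n) : is_derive (0 : R) 1 (fun=> C) 0 by exact: is_derive_cst.
have [_ ->] := is_derive_metric hl (hc Y) (hc Z) A0'.
by rewrite scale0r add0r !mulmx0 !sub0r raddfN/= mulNmx mulmxN !raddfN.
Qed.

(** With [Y] and [W] the body velocities of [X] and [Z], everything follows from
    [d (A^-1) = - A^-1 dA A^-1]; the two traces in the [Z] derivative of the metric
    coincide by transposition. *)
Lemma christoffelE A X Z : 0 < \det A ->
  let Y := invmx A *m X in let W := invmx A *m Z in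
  christoffel A X X Z =
    - \tr ((Y *m Y)^T *m W) - \tr (Y^T *m Y *m W) + \tr ((W *m Y)^T *m Y).
Proof.
move=> A0 Y W; rewrite /christoffel !derive_metric// -!(mulmxA _ (invmx A)) -/Y -/W.
have -> : \tr (Y^T *m (W *m Y)) = \tr ((W *m Y)^T *m Y).
  by rewrite -mxtrace_tr trmx_mul trmxK.
rewrite -!mulmxA.
by lra.
Qed.

End Christoffel.

(** * The curves t |-> diag (exp (a_i + t b_i)) *)

Section DiagonalCurves.
Context {R : realType} {n : nat}.
Implicit Types a b c : 'rV[R]_n.

(** The weights [c] make this family stable under differentiation. *)
Definition diag_curve c a b (t : R) : 'M[R]_n :=
  diag_mx (\row_i (c 0 i * expR (a 0 i + t * b 0 i))).

Definition exp_curve a b := diag_curve (const_mx 1) a b.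

Lemma is_derive_diag_curve c a b (t : R) :
  is_derive t 1 (diag_curve c a b) (diag_curve (\row_i (c 0 i * b 0 i)) a b t).
Proof.
apply/is_derive_mxP => i j.
rewrite (_ : (fun _ => _) = fun s => c 0 i * expR (a 0 i + s * b 0 i) * (i == j)%:R); last first.
  by apply/funext => s; rewrite !mxE mulr_natr.
have h1 := is_derive_fD (is_derive_f_cst (a 0 i) t)
  (is_derive_fM (is_derive_id t (1 : R)) (is_derive_f_cst (b 0 i) t)).
have h2 := @is_derive1_comp R (@expR R) (fun s => a 0 i + s * b 0 i) t _ _ (is_derive_expR _) h1.
have h3 := is_derive_fM (is_derive_fM (is_derive_f_cst (c 0 i) t) h2)
  (is_derive_f_cst (i == j)%:R t).
apply: is_derive_eq h3 _; rewrite !mxE -mulr_natr /=.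
by ring.
Qed.

Lemma derive1_diag_curve c a b :
  derive1 (diag_curve c a b) = diag_curve (\row_i (c 0 i * b 0 i)) a b.
Proof.
by apply/funext => t; rewrite derive1E; have [] := is_derive_diag_curve c a b t.
Qed.

Lemma derive1n_diag_curve k c a b :
  derive1n k (diag_curve c a b) = diag_curve (\row_i (c 0 i * b 0 i ^+ k)) a b.
Proof.
elim: k => [|k ih].
  rewrite derive1n0; congr diag_curve; apply/rowP => i; rewrite mxE expr0 mulr1//.
rewrite derive1nS ih derive1_diag_curve; congr diag_curve.
by apply/rowP => i; rewrite !mxE exprSr mulrA.
Qed.

Lemma Ck_diag_curve k c a b : Ck k (diag_curve c a b).
Proof.
have d c' t : derivable (diag_curve c' a b) t 1.
  by have [] := is_derive_diag_curve c' a b t.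
split=> j _; rewrite derive1n_diag_curve // => t.
exact/differentiable_continuous/derivable1_diffP.
Qed.

Lemma exp_curve_det_gt0 a b t : 0 < \det (exp_curve a b t).
Proof. by rewrite det_diag prodr_gt0// => i _; rewrite !mxE mul1r expR_gt0. Qed.

Lemma mul_exp_curve c a b t : exp_curve a b t *m diag_mx c = diag_curve c a b t.
Proof.
rewrite mulmx_diag; congr diag_mx; apply/rowP => i.
by rewrite !mxE mul1r mulrC.
Qed.

Lemma exp_curve_velocity a b t :
  invmx (exp_curve a b t) *m derive1 (exp_curve a b) t = diag_mx b.
Proof.
rewrite derive1_diag_curve (_ : \row_i _ = b); last by apply/rowP => i; rewrite !mxE mul1r.
by rewrite -mul_exp_curve mulKmx// det_gt0_unit// exp_curve_det_gt0.
Qed.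

Lemma frob2_diag b : frob2 (diag_mx b) = \sum_i b 0 i ^+ 2.
Proof.
rewrite /frob2 tr_diag_mx mulmx_diag mxtrace_diag; apply: eq_bigr => i _.
by rewrite mxE expr2.
Qed.

Lemma speed_exp_curve a b t : speed (exp_curve a b) t = norm2 (b 0).
Proof. by rewrite /speed /metric exp_curve_velocity -/(frob2 _) frob2_diag. Qed.

Lemma const_speed_length (gamma : R -> 'M[R]_n) (q : R) :
  {in `]0, 1[%R, speed gamma =1 cst q} -> curve_length gamma = q%:E.
Proof.
move=> e; rewrite /curve_length.
have mq : measurable_fun (`]0, 1[ : set R) (cst q : R -> R) by exact: measurable_cst.
have mg : measurable_fun (`]0, 1[ : set R) (speed gamma).
  by apply: eq_measurable_fun mq => x /set_mem xab; rewrite e.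
rewrite (eq_integral_itv_bounded _ _ mg mq e).
have /= -> := @integral_cst _ _ _ (@lebesgue_measure R) `[0, 1] (measurable_itv _) q%:E.
by rewrite lebesgue_measure_itv/= lte_fin ltr01 oppr0 adde0 mule1.
Qed.

Lemma exp_curve_length a b : curve_length (exp_curve a b) = (norm2 (b 0))%:E.
Proof. by apply: const_speed_length => t _; exact: speed_exp_curve. Qed.

Lemma rdist_exp_curve a b (A B : 'M[R]_n) :
  exp_curve a b 0 = A -> exp_curve a b 1 = B -> (rdist A B <= (norm2 (b 0))%:E)%E.
Proof.
move=> e0 e1; rewrite -(exp_curve_length a b); apply: ereal_inf_lbound.
exists (exp_curve a b) => //; split.
  exists [:: 1]; split=> //=; first by rewrite ltr01.
  by case=> // _; exists (exp_curve a b) => //; exact: Ck_diag_curve.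
by split=> // t _; exact: exp_curve_det_gt0.
Qed.

(** The body velocity is the constant diagonal matrix [b], so the acceleration
    term is [tr (b^2 W)], while the Christoffel term is [- tr (b^2 W)]. *)
Lemma exp_curve_geodesic a b : geodesic (exp_curve a b).
Proof.
split; first by exists (exp_curve a b) => //; exact: Ck_diag_curve.
move=> t _ Z; have d0 := exp_curve_det_gt0 a b t.
have u := det_gt0_unit d0.
rewrite christoffelE// exp_curve_velocity /metric derive1n_diag_curve.
rewrite (_ : invmx _ *m diag_curve _ a b t = diag_mx b *m diag_mx b); last first.
  rewrite mulmx_diag -[diag_mx (\row_j _)](mulKmx u) mul_exp_curve;
    congr (_ *m diag_curve _ _ _ _).
  by apply/rowP => i; rewrite !mxE mul1r expr2.
move: (invmx _ *m Z) => W; rewrite !trmx_mul !tr_diag_mx.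
have -> : \tr (diag_mx b *m W^T *m diag_mx b) = \tr (diag_mx b *m diag_mx b *m W).
  by rewrite -mxtrace_tr !trmx_mul trmxK tr_diag_mx mxtrace_mulC -mulmxA mxtrace_mulC.
by ring.
Qed.

End DiagonalCurves.


(** * The matrix exponential of a diagonal matrix *)

Section ExpDiag.
Context {R : realType} {n : nat}.

Lemma cvg_mx_coord (u : nat -> 'M[R]_n) (l : 'M[R]_n) :
  (forall i j, (fun k => u k i j) @ \oo --> l i j) -> u @ \oo --> l.
Proof.
move=> h; apply/cvgrPdist_le => /= e e0; near=> k.
rewrite /Num.Def.normr/= mx_normrE (bigmax_le _ (ltW e0))//= => i _.
rewrite !mxE/=; move: i; near: k; apply: filter_forall => /= i.
exact: ((cvgrPdist_le _ _).1 (h i.1 i.2)).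
Unshelve. all: by end_near. Qed.

Lemma diag_mx_exp (v : 'rV[R]_n) k : diag_mx v ^+ k = diag_mx (\row_i v 0 i ^+ k).
Proof.
elim: k => [|k ih].
  by apply/matrixP => i j; rewrite expr0 !mxE expr0.
rewrite exprS ih [LHS]mulmx_diag; congr diag_mx; apply/rowP => i.
by rewrite !mxE exprS.
Qed.

Lemma expmx_diag (v : 'rV[R]_n) : expmx (diag_mx v) = diag_mx (map_mx expR v).
Proof.
apply/cvg_lim => //; apply: cvg_mx_coord => i j.
have e : (fun k => series (fun k => (k`!%:R)^-1 *: diag_mx v ^+ k) k i j) =
    (fun k => series (exp_coeff (v 0 i)) k * (i == j)%:R).
  apply/funext => k; rewrite /series/= summxE mulr_suml; apply: eq_bigr => m _.
  by rewrite diag_mx_exp !mxE /exp_coeff/=; case: (i == j); rewrite ?mulr0// !mulr1 mulrC.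
have h : series (exp_coeff (v 0 i)) @ \oo --> expR (v 0 i).
  exact: is_cvg_series_exp_coeff.
rewrite e !mxE -[X in _ --> X]mulr_natr; exact: cvgMr_tmp h.
Qed.

Lemma expmx_exp_curve (v : 'rV[R]_n) (t : R) :
  expmx (t *: diag_mx v) = exp_curve 0 v t.
Proof.
rewrite -linearZ/= expmx_diag; congr diag_mx; apply/rowP => i.
by rewrite !mxE mul1r add0r.
Qed.

End ExpDiag.

(** * The distance from a diagonal matrix to the rotations *)

Section DistanceToSO.
Context {R : realType} {n : nat}.
Implicit Types (lambda : 'rV[R]_n) (B : 'M[R]_n).

Lemma chart_diag lambda (k : @coord_index n) : (forall i, 0 < lambda 0 i) ->
  chart (diag_mx lambda) k =
  match k with inl i => ln (lambda 0 i) | inr p => (p.1 == p.2)%:R / Num.sqrt 2 end.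
Proof.
move=> l0; case: k => [i|p] /=; last by rewrite gs_mx_diag// mxE.
by rewrite /gs_tri gs_mx_diag// trmx1 mulmx1 mxE eqxx.
Qed.

Lemma chart_orthogonal B (k : @coord_index n) : B^T *m B = 1%:M ->
  chart B k = match k with inl i => 0 | inr p => B p.1 p.2 / Num.sqrt 2 end.
Proof.
move=> /mulmx1C BB; case: k => [i|p] /=; last by rewrite gs_mx_orthogonal.
by rewrite /gs_tri gs_mx_orthogonal// BB mxE eqxx ln1.
Qed.

Lemma chart_1 (k : @coord_index n) : chart (1%:M : 'M[R]_n) k =
  match k with inl i => 0 | inr p => (p.1 == p.2)%:R / Num.sqrt 2 end.
Proof. by rewrite chart_orthogonal ?trmx1 ?mulmx1//; case: k => // p; rewrite mxE. Qed.

(** This Pythagorean formula is what makes the minimizer unique: a rotation [B]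
    other than the identity pays the extra amount [|B - 1|^2 / 2], a bound on the
    infimum itself that does not involve minimal curves from [D] to [B]. *)
Lemma chart_dist lambda B : (forall i, 0 < lambda 0 i) -> B^T *m B = 1%:M ->
  norm2 (fun k => chart B k - chart (diag_mx lambda) k) ^+ 2 =
  norm2 (map_mx (@ln R) lambda 0) ^+ 2 +
  2^-1 * frob2 (B - 1%:M).
Proof.
move=> l0 BB; rewrite !sqr_norm2 sum_coord; congr (_ + _).
  by apply: eq_bigr => i _; rewrite chart_orthogonal// chart_diag// mxE sub0r sqrrN.
rewrite frob2E mulr_sumr; apply: eq_bigr => i _; rewrite mulr_sumr.
apply: eq_bigr => j _; rewrite chart_orthogonal// chart_diag//= -mulrBl.
by rewrite expr_div_n sqr_sqrtr// mulrC !mxE.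
Qed.

Lemma diag_curve0 c b : diag_curve c 0 b 0 = diag_mx c :> 'M[R]_n.
Proof. by congr diag_mx; apply/rowP => i; rewrite !mxE mul0r addr0 expR0 mulr1. Qed.

Section FixedDiagonal.
Context (lambda : 'rV[R]_n) (lambda_gt0 : forall i, 0 < lambda 0 i).
Let D := diag_mx lambda.
Let b := map_mx (@ln R) lambda.

Lemma exp_curve_log0 : exp_curve 0 b 0 = 1%:M.
Proof. by rewrite /exp_curve diag_curve0; apply/matrixP => i j; rewrite !mxE. Qed.

Lemma exp_curve_log1 : exp_curve 0 b 1 = D.
Proof.
congr diag_mx; apply/rowP => i.
by rewrite !mxE mul1r add0r mul1r lnK// posrE.
Qed.

Lemma rdist_SO_ge B : B^T *m B = 1%:M -> ((norm2 (b 0%R))%:E <= rdist D B)%E.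
Proof.
move=> BB; apply: le_trans (rdist_ge _ _); rewrite lee_fin.
by rewrite -ler_sqr ?nnegrE ?norm2_ge0// chart_dist// lerDl mulr_ge0// frob2_ge0.
Qed.

Lemma rdist_diag_1 : rdist D 1%:M = (norm2 (b 0))%:E.
Proof.
apply/eqP; rewrite eq_le rdist_SO_ge ?trmx1 ?mulmx1// andbT.
have -> : norm2 (b 0) = norm2 ((- b) 0).
  by rewrite /norm2; congr Num.sqrt; apply: eq_bigr => i _; rewrite !mxE sqrrN.
(* The curve with exponents b - t b runs backwards from D to 1. *)
apply: (@rdist_exp_curve _ _ b).
  congr diag_mx; apply/rowP => i.
  by rewrite !mxE mul0r addr0 mul1r lnK// posrE.
by apply/matrixP => i j; rewrite !mxE !mul1r subrr expR0.
Qed.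

Lemma rdist_1_diag : rdist 1%:M D = (norm2 (b 0))%:E.
Proof.
apply/eqP; rewrite eq_le (rdist_exp_curve exp_curve_log0 exp_curve_log1)/=.
apply: le_trans (rdist_ge _ _); rewrite lee_fin.
have -> : norm2 (fun k => chart D k - chart 1%:M k) = norm2 (fun k => chart 1%:M k - chart D k).
  by rewrite /norm2; congr Num.sqrt; apply: eq_bigr => k _; rewrite -sqrrN opprB.
by rewrite -ler_sqr ?nnegrE ?norm2_ge0// chart_dist ?trmx1 ?mulmx1// lerDl mulr_ge0// frob2_ge0.
Qed.

Lemma SO1 : SO (1%:M : 'M[R]_n).
Proof. by split; rewrite ?trmx1 ?mulmx1 ?det1. Qed.

Lemma rdist_set_SO : rdist_set D SO = rdist D 1%:M.
Proof.
apply/eqP; rewrite eq_le; apply/andP; split.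
  by apply: ereal_inf_lbound; exists 1%:M => //; exact: SO1.
by apply: le_ereal_inf_tmp => _ [B [BB _] <-]; rewrite rdist_diag_1 rdist_SO_ge.
Qed.

Lemma rdist_SO_eq B : SO B -> rdist D B = rdist_set D SO <-> B = 1%:M.
Proof.
move=> [BB _]; split=> [|->]; last by rewrite rdist_set_SO.
rewrite rdist_set_SO rdist_diag_1 => e.
have := rdist_ge D B; rewrite e lee_fin.
rewrite -ler_sqr ?nnegrE ?norm2_ge0// chart_dist// gerDl pmulr_rle0 ?invr_gt0// => le.
apply/eqP; rewrite -subr_eq0; apply/eqP/frob2_eq0/eqP.
by rewrite eq_le le frob2_ge0.
Qed.

End FixedDiagonal.
End DistanceToSO.

(** * Uniqueness of the minimal geodesic *)

Section StraightLine.
Context {R : realType} {I : finType}.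

(** Equality in the triangle inequality in a Euclidean space. *)
Lemma straight_line (p w : I -> R) (c t : R) : 0 <= t -> t <= 1 -> norm2 w = c ->
  norm2 p <= c * t -> norm2 (fun k => w k - p k) <= c * (1 - t) ->
  forall k, p k = t * w k.
Proof.
move=> t0 t1 wc pc qc k; apply/eqP; rewrite -subr_eq0; apply/eqP.
have c0 : 0 <= c by rewrite -wc norm2_ge0.
move: pc; rewrite -ler_sqr ?nnegrE ?norm2_ge0 ?mulr_ge0// sqr_norm2 => pc.
move: qc; rewrite -ler_sqr ?nnegrE ?norm2_ge0 ?mulr_ge0 ?subr_ge0// sqr_norm2 => qc.
apply: (@sum_sqr_eq0 R I (fun k => p k - t * w k)); apply/eqP.
rewrite eq_le sum_sqr_ge0 andbT.
have e1 : \sum_k (w k - p k) ^+ 2 =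
    c ^+ 2 - 2 * (\sum_k p k * w k) + \sum_k p k ^+ 2.
  rewrite -wc sqr_norm2 mulr_sumr -sumrB -big_split; apply: eq_bigr => i _ /=.
  by ring.
have -> : \sum_k (p k - t * w k) ^+ 2 =
    \sum_k p k ^+ 2 - 2 * t * (\sum_k p k * w k) + t ^+ 2 * c ^+ 2.
  rewrite -wc sqr_norm2 !mulr_sumr -sumrB -big_split; apply: eq_bigr => i _ /=.
  by ring.
rewrite e1 in qc.
move: (\sum_k p k ^+ 2) (\sum_k p k * w k) pc qc => P Q pc qc.
(* The squared distance from p to t w is minus a convex combination of the
   slacks of the two hypotheses. *)
have h1 : 0 <= (1 - t) * ((c * t) ^+ 2 - P) by rewrite mulr_ge0// subr_ge0.
have h2 : 0 <= t * ((c * (1 - t)) ^+ 2 - (c ^+ 2 - 2 * Q + P)) by rewrite mulr_ge0// subr_ge0.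
have -> : P - 2 * t * Q + t ^+ 2 * c ^+ 2 =
  - ((1 - t) * ((c * t) ^+ 2 - P) + t * ((c * (1 - t)) ^+ 2 - (c ^+ 2 - 2 * Q + P))).
  by ring.
by rewrite oppr_le0 addr_ge0.
Qed.

Lemma constant_segment (f : R -> R) :
  {in `]0, 1[%R, forall t : R, is_derive t 1 f 0} ->
  {in `[0, 1]%R, forall t, {for t, continuous f}} ->
  {in `[0, 1]%R, forall t, f t = f 0}.
Proof.
move=> df cf t; rewrite in_itv/= => /andP[t0 t1].
have df' (x : R) : x \in `]0, t[%R -> is_derive x 1 f 0.
  rewrite in_itv/= => /andP[x0 xt]; apply: df.
  by rewrite in_itv/= x0 (lt_le_trans xt).
have cf' : {within `[0, t], continuous f}.
  apply: continuous_in_subspaceT => x /set_mem; rewrite /= in_itv/= => /andP[x0 xt].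
  by apply: cf; rewrite in_itv/= x0 (le_trans xt).
have [s _] := @MVT_segment R f (fun=> 0) 0 t t0 df' cf'.
by rewrite mul0r => /eqP; rewrite subr_eq0 => /eqP.
Qed.

End StraightLine.

Section Geodesics.
Context {R : realType} {n : nat}.
Implicit Types (sigma tau : R -> 'M[R]_n).

(** Testing the geodesic equation against the velocity gives half of the
    derivative of the squared speed. The curve [tau] extends [sigma] smoothly, so
    that derivatives make sense at 0 and 1. *)
Lemma geodesic_const_speed sigma :
  geodesic sigma -> {in `[0, 1]%R, forall t, GLpos (sigma t)} ->
  exists tau, exists q, [/\ forall t, derivable tau t 1,
    {in `[0, 1]%R, sigma =1 tau},
    {in `]0, 1[%R, speed sigma =1 speed tau} &
    {in `[0, 1]%R, forall t, metric (tau t) (derive1 tau t) (derive1 tau t) = q}].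
Proof.
move=> [[tau [ds cs] e] geo] det0.
exists tau; pose m t := metric (tau t) (derive1 tau t) (derive1 tau t).
exists (m 0).
have d0 t : derivable tau t 1 by exact: (ds 0%N).
have d1 t : derivable (derive1 tau) t 1 by exact: (ds 1%N).
have tdet0 : {in `[0, 1]%R, forall t, 0 < \det (tau t)}.
  by move=> t t01; rewrite -e// det0.
have near_e := eq_itv_near e.
split; [exact: d0|exact: e| |].
  by move=> t t01; exact/speed_eq_near/near_e.
apply: constant_segment; last first.
  move=> t t01; apply: continuous_metric; [exact: d0|exact: tdet0|].
  exact/differentiable_continuous/derivable1_diffP/d1.
move=> t t01; have tdet := tdet0 t (subset_itv_oo_cc t01).
have h0 : is_derive t 1 tau (derive1 tau t) by rewrite derive1E; exact: derivableP.
have h1 : is_derive t 1 (derive1 tau) (derive1n 2 tau t).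
  by rewrite derive1nS derive1n1 derive1E; exact: derivableP.
apply: is_derive_eq (is_derive_metric h0 h1 h1 tdet) _.
have e0 : sigma t = tau t by rewrite e// subset_itv_oo_cc.
have e1 s : s \in `]0, 1[%R -> derive1 sigma s = derive1 tau s.
  by move=> s01; rewrite !derive1E; apply: near_eq_derive; exact: near_e.
have e2 : derive1n 2 sigma t = derive1n 2 tau t.
  rewrite !derive1nS !derive1n0 !(derive1E _ t); apply: near_eq_derive.
  by apply: filterS (near_in_itvoo t01) => s; exact: e1.
have := geo t t01 (derive1 tau t).
rewrite e0 (e1 t t01) e2 (christoffelE _ _ tdet) /metric.
set Y := invmx _ *m derive1 tau t; set A := invmx _ *m derive1n 2 tau t.
rewrite -(mulmxA Y (invmx _)) -/Y => g.
have s1 : \tr (Y^T *m (A - Y *m Y)) = \tr ((A - Y *m Y)^T *m Y).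
  by rewrite -mxtrace_tr trmx_mul trmxK.
have s2 : \tr (Y^T *m Y *m Y) = \tr ((Y *m Y)^T *m Y).
  by rewrite -mxtrace_tr !trmx_mul !trmxK mulmxA mxtrace_mulC mulmxA.
rewrite s1 !(raddfB, mulmxBl)/=.
by rewrite s2 subrK in g; rewrite g addr0.
Qed.

Lemma const_speed_chart tau (c : R) :
  (forall t, derivable tau t 1) -> {in `[0, 1]%R, forall t, 0 < \det (tau t)} ->
  {in `[0, 1]%R, forall t, Num.sqrt (metric (tau t) (derive1 tau t) (derive1 tau t)) = c} ->
  {in `[0, 1]%R &, forall s t, s <= t ->
    norm2 (fun k => chart (tau t) k - chart (tau s) k) <= c * (t - s)}.
Proof.
move=> dt det0 hc s t s01 t01 st.
set v := fun k => _.
have c0 : 0 <= c by rewrite -(hc s s01) sqrtr_ge0.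
pose h x := pairing v (tau x).
have sub x : x \in `[s, t]%R -> x \in `[0, 1]%R.
  move: s01 t01; rewrite !in_itv/= => /andP[s0 _] /andP[_ t1] /andP[sx xt].
  by rewrite (le_trans s0)// (le_trans xt).
have hv x : x \in `[s, t]%R -> derivable h x 1 /\ derive1 h x <= norm2 v * c.
  by move=> /sub x01; have [? ?] := pairing_velocity v (dt x) (det0 x x01); rewrite -(hc x).
have dh x : x \in `]s, t[%R -> is_derive x 1 h (derive1 h x).
  move=> xst; rewrite derive1E; apply: derivableP.
  by have [] := hv x (subset_itv_oo_cc xst).
have ch : {within `[s, t], continuous h}.
  by apply: derivable_within_continuous => x /hv[].
have [x xst E] := @MVT_segment R h (fun x => derive1 h x) s t st dh ch.
have [_ le] := hv x xst.
have N : h t - h s = norm2 v ^+ 2.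
  rewrite sqr_norm2 /h /pairing -sumrB; apply: eq_bigr => k _.
  by rewrite -mulrBr expr2.
have {}le : norm2 v ^+ 2 <= norm2 v * c * (t - s).
  by rewrite -N E ler_wpM2r// subr_ge0.
have [v0|v0] := eqVneq (norm2 v) 0; first by rewrite v0 mulr_ge0// subr_ge0.
by move: le; rewrite expr2 -mulrA ler_pM2l// lt_neqAle eq_sym v0 norm2_ge0.
Qed.

(** The diagonal already accounts for the whole norm. *)
Lemma diag_of_norm (Y : 'M[R]_n) (b : 'rV[R]_n) :
  (forall i, Y i i = b 0 i) -> frob2 Y = frob2 (diag_mx b) -> Y = diag_mx b.
Proof.
move=> Yd; rewrite frob2_diag frob2E sum_diag_upper => /eqP.
under [X in X + _]eq_bigr do rewrite Yd.
rewrite -[X in _ == X]addr0 (inj_eq (addrI _)) psumr_eq0; last first.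
  by move=> i _; apply: sumr_ge0 => j _; rewrite addr_ge0 ?sqr_ge0.
move=> /allP Y0.
have {}Y0 (i j : 'I_n) : (i < j)%N -> Y i j = 0 /\ Y j i = 0.
  move=> ij; have := Y0 i; rewrite mem_index_enum => /(_ isT)/=.
  rewrite psumr_eq0 => [/allP/(_ j)|k _]; last by rewrite addr_ge0 ?sqr_ge0.
  rewrite mem_index_enum ij => /(_ isT)/=.
  by rewrite paddr_eq0 ?sqr_ge0// !sqrf_eq0 => /andP[/eqP ? /eqP ?].
apply/matrixP => i j; rewrite mxE; have [ij|ij|/val_inj <-] := ltngtP i j.
- by rewrite (Y0 _ _ ij).1 (ltn_eqF ij : (i == j) = false).
- by rewrite (Y0 _ _ ij).2 (gtn_eqF ij : (i == j) = false).
- by rewrite Yd eqxx.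
Qed.

(** The equation decouples into columns: [tau_ij exp (- t b_j)] is constant. *)
Lemma exp_curve_ode tau (b : 'rV[R]_n) : (forall t, derivable tau t 1) ->
  tau 0 = 1%:M ->
  (forall t, t \in `]0, 1[%R -> derive1 tau t = tau t *m diag_mx b) ->
  {in `[0, 1]%R, tau =1 exp_curve 0 b}.
Proof.
move=> dt t0 V t t01; apply/matrixP => i j.
pose f s := tau s i j * expR (- (s * b 0 j)).
have df s : derivable tau s 1 -> is_derive s 1 f
    ((derive1 tau s) i j * expR (- (s * b 0 j)) + tau s i j * (- b 0 j * expR (- (s * b 0 j)))).
  move=> dts; have ht : is_derive s 1 tau (derive1 tau s) by rewrite derive1E; exact: derivableP.
  have /is_derive_mxP/(_ i j) h1 := ht.
  have h2 := is_derive_fN (is_derive_fM (is_derive_id s (1 : R)) (is_derive_f_cst (b 0 j) s)).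
  have h3 := @is_derive1_comp R (@expR R) (fun s => - (s * b 0 j)) s _ _ (is_derive_expR _) h2.
  apply: is_derive_eq (is_derive_fM h1 h3) _ => /=.
  by ring.
have /(_ t t01) : {in `[0, 1]%R, forall t, f t = f 0}.
  apply: constant_segment => s s01.
    apply: is_derive_eq (df s (dt s)) _.
    rewrite (V s s01) mxE (bigD1 j)//= big1 => [|k kj]; last by rewrite mxE (negbTE kj) mulr0.
    by rewrite mxE eqxx mulr1n; ring.
  by have [ex _] := df s (dt s); exact: derivable_continuous.
rewrite /f t0 !mxE mul0r oppr0 expR0 mulr1 => h.
have : tau t i j = (i == j)%:R * expR (t * b 0 j).
  by rewrite -h -mulrA -expRD addNr expR0 mulr1.
by move=> ->; rewrite mul1r add0r; case: eqP => [->|_]; rewrite ?mul1r ?mul0r.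
Qed.

(** A minimal geodesic has constant speed equal to the distance of the images of
    its ends in the chart, so the chart maps it to a straight segment. Thus its
    orthogonal factor is 1 and the diagonal of its triangular factor is known;
    this diagonal alone uses up the speed, so the body velocity is diagonal. *)
Lemma minimal_geodesic_diag (lambda : 'rV[R]_n) sigma : (forall i, 0 < lambda 0 i) ->
  minimal_geodesic 1%:M (diag_mx lambda) sigma ->
  {in `[0, 1]%R, sigma =1 exp_curve 0 (map_mx (@ln R) lambda)}.
Proof.
move=> l0 [[s0 s1 sdet] geo]; rewrite rdist_1_diag// => len.
set b := map_mx _ _ in len *.
set c := norm2 (b 0) in len.
have [tau [q [dt e es hq]]] := geodesic_const_speed geo sdet.
have tdet : {in `[0, 1]%R, forall t, 0 < \det (tau t)}.
  by move=> t t01; rewrite -e// sdet.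
have sqc : Num.sqrt q = c.
  have h : {in `]0, 1[%R, speed sigma =1 cst (Num.sqrt q)}.
    by move=> t t01; rewrite es// /speed hq// subset_itv_oo_cc.
  by move: len; rewrite (const_speed_length h) => -[].
have lip : {in `[0, 1]%R &, forall s t, s <= t ->
    norm2 (fun k => chart (tau t) k - chart (tau s) k) <= c * (t - s)}.
  by apply: const_speed_chart => // t t01; rewrite hq.
have i0 : (0 : R) \in `[0, 1]%R by rewrite in_itv/= lexx ler01.
have i1 : (1 : R) \in `[0, 1]%R by rewrite in_itv/= lexx ler01.
have t0 : tau 0 = 1%:M by rewrite -e.
have t1 : tau 1 = diag_mx lambda by rewrite -e.
pose w (k : @coord_index n) := chart (tau 1) k - chart (tau 0) k.
have w_inl i : w (inl i) = b 0 i.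
  by rewrite /w t1 t0 chart_diag// chart_1 mxE subr0.
have w_inr p : w (inr p) = 0.
  by rewrite /w t1 t0 chart_diag// chart_1 subrr.
have wc : norm2 w = c.
  rewrite /c /norm2 sum_coord; congr Num.sqrt.
  rewrite [X in _ + X]big1 => [|i _]; last by rewrite big1// => j _; rewrite w_inr expr0n.
  by rewrite addr0; apply: eq_bigr => i _; rewrite w_inl.
have F t : t \in `[0, 1]%R -> forall k, chart (tau t) k = chart (tau 0) k + t * w k.
  move=> t01 k; have := t01; rewrite in_itv/= => /andP[tge0 tle1].
  have := @straight_line R _ (fun k => chart (tau t) k - chart (tau 0) k) w c t tge0 tle1 wc.
  move=> /(_ _ _ k) <-; first by rewrite addrC subrK.
    by rewrite -[X in c * X]subr0; exact: lip.
  rewrite (_ : (fun _ => _) = fun k => chart (tau 1) k - chart (tau t) k); first exact: lip.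
  by apply/funext => l; rewrite /w; ring.
have tu t : t \in `[0, 1]%R -> tau t \in unitmx by move=> t01; exact/det_gt0_unit/tdet.
have s2 : Num.sqrt (2 : R) != 0 by rewrite gt_eqF// sqrtr_gt0.
have K1 t : t \in `[0, 1]%R -> gs_mx (tau t) = 1%:M.
  move=> t01; apply/matrixP => i j; rewrite [RHS]mxE; have := F t t01 (inr (i, j)).
  rewrite w_inr mulr0 addr0 t0 chart_1 /= => /(congr1 (fun x => x * Num.sqrt 2)).
  by rewrite !(divfK s2).
have Lii t i : t \in `[0, 1]%R -> ln (gs_tri (tau t) i i) = t * b 0 i.
  move=> t01; have -> : ln (gs_tri (tau t) i i) = chart (tau t) (inl i) by [].
  by rewrite (F t t01) w_inl t0 chart_1 add0r.
have V t : t \in `]0, 1[%R -> derive1 tau t = tau t *m diag_mx b.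
  move=> t01; have t01' := subset_itv_oo_cc t01.
  have ht : is_derive t 1 tau (derive1 tau t) by rewrite derive1E; exact: derivableP.
  have [dK [dL [_ hL Zd _]]] := gs_velocity ht (tdet t t01').
  rewrite K1// trmx1 mulmx1 mul1mx in Zd.
  set Y := invmx (tau t) *m derive1 tau t in Zd.
  have Yd i : Y i i = b 0 i.
    rewrite Zd; have /is_derive_mxP/(_ i i) hLi := hL.
    have [_ <-] : is_derive t 1 (fun s => ln (gs_tri (tau s) i i)) (dL i i / gs_tri (tau t) i i).
      by rewrite mulrC; apply: (is_derive1_comp (is_derive1_ln (gs_tri_gt0 i (tu t t01'))) hLi).
    have [_ <-] : is_derive t 1 (fun s : R => s * b 0 i) (b 0 i).
      apply: is_derive_eq (is_derive_fM (is_derive_id t (1 : R)) (is_derive_f_cst (b 0 i) t)) _.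
      by rewrite mul1r mulr0 addr0.
    apply: near_eq_derive; apply: filterS (near_in_itvoo t01) => s s01.
    by rewrite Lii// subset_itv_oo_cc.
  have YE : Y = diag_mx b.
    apply: diag_of_norm Yd _; rewrite -[LHS]/(metric _ _ _) hq// frob2_diag.
    rewrite -sqr_norm2 -/c -sqc sqr_sqrtr// -(hq t t01').
    exact: frob2_ge0.
  by rewrite -YE /Y mulKVmx// tu.
by move=> t t01; rewrite e//; exact: (exp_curve_ode dt t0 V).
Qed.

End Geodesics.

Theorem lemma4p1 (R : realType) (n : nat) (lambda : 'rV[R]_n)
    (lambda_gt0 : forall i : 'I_n, 0 < lambda 0 i) :
  let D : 'M[R]_n := diag_mx lambda in
  let logD : 'M[R]_n := diag_mx (map_mx (@ln R) lambda) in
  let gamma : R -> 'M[R]_n := fun t => expmx (t *: logD) in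
  [/\ rdist_set D SO = rdist D 1%:M,
      forall B : 'M[R]_n, SO B -> (rdist D B = rdist_set D SO <-> B = 1%:M),
      minimal_geodesic 1%:M D gamma &
      forall sigma : R -> 'M[R]_n, minimal_geodesic 1%:M D sigma ->
        {in `[0, 1]%R, sigma =1 gamma}].
Proof.
move=> D logD gamma.
have -> : gamma = exp_curve 0 (map_mx (@ln R) lambda).
  by apply/funext => t; exact: expmx_exp_curve.
split.
- exact: rdist_set_SO.
- by move=> B; exact: rdist_SO_eq.
- split; first by split; [exact: exp_curve_log0|exact: exp_curve_log1|
    move=> t _; exact: exp_curve_det_gt0].
  + exact: exp_curve_geodesic.
  + by rewrite exp_curve_length rdist_1_diag.
- by move=> sigma; exact: minimal_geodesic_diag.
Qed.
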